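(* Let $m,n$ be positive integers and $k\ge 2$ an integer. Let $P\in\mathbb{R}[x_1,\ldots,x_n]$ be a polynomial that has a zero of multiplicity at least $k$ at every point of $mB^n\setminus\{\mathbf 0\}$ and a zero of multiplicity exactly $l$ at $\mathbf 0$, where $l\ge 0$ is an integer. (i) If $l=k-1$, then $\deg P\ge mn+(m+1)(k-1)$. (ii) If $l\le k-2$, $k\in\{2,3,4\}$ and $n\ge k-1$, then $\deg P\ge mn+(m+1)(k-1)-1$. Moreover both bounds are attained. In case (i) there is such a polynomial with $l=k-1$ and $\deg P=mn+(m+1)(k-1)$. In case (ii), for every $l\in\{0,\ldots,k-2\}$ there is such a polynomial with zero multiplicity exactly $l$ at $\mathbf 0$ and $\deg P=mn+(m+1)(k-1)-1$.
   Context: $mB^n=\{0,1,\ldots,m\}^n\subseteq\mathbb{R}^n$. For a nonzero polynomial $f\in\mathbb{R}[x_1,\ldots,x_n]$ and a point $\mathbf a=(a_1,\ldots,a_n)$, the multiplicity of the zero of $f$ at $\mathbf a$ is the minimum total degree of a monomial occurring in the expansion of $f(x_1+a_1,\ldots,x_n+a_n)$; multiplicity $0$ means $f(\mathbf a)\neq 0$. The zero polynomial has a zero of every multiplicity. Equivalently, $f$ has a zero of multiplicity at least $k$ at $\mathbf a$ if and only if all partial derivatives of $f$ of order less than $k$ vanish at $\mathbf a$. *)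

(* Defs.v *)
From HB Require Import structures.
From mathcomp Require Import all_boot all_order all_algebra.
From mathcomp Require Import mpoly.
From mathcomp Require Import Rstruct.
Set Implicit Arguments. Unset Strict Implicit. Unset Printing Implicit Defensive.
Import GRing.Theory.
Local Open Scope ring_scope.

Notation RR := Rdefinitions.R.

Definition shift_mpoly (n : nat) (P : {mpoly RR[n]}) (a : 'I_n -> RR) : {mpoly RR[n]} :=
  P \mPo [tuple ('X_i + (a i)%:MP) | i < n].

(* f has a zero of multiplicity at least k at a: every monomial occurring in
   f(x + a) has total degree >= k (vacuous for the zero polynomial). *)
Definition mult_ge (n : nat) (P : {mpoly RR[n]}) (a : 'I_n -> RR) (k : nat) : Prop :=
  forall mo, mo \in msupp (shift_mpoly P a) -> (k <= mdeg mo)%N.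

(* f has a zero of multiplicity exactly l at a
   (the minimum total degree of a monomial of f(x+a) is l; f <> 0). *)
Definition mult_eq (n : nat) (P : {mpoly RR[n]}) (a : 'I_n -> RR) (l : nat) : Prop :=
  mult_ge P a l /\ ~ mult_ge P a l.+1.

(* total degree (msize is 1 + total degree, 0 for the zero polynomial) *)
Definition tdeg (n : nat) (P : {mpoly RR[n]}) : nat := (msize P).-1.

Definition grid_nz (m n : nat) (c : 'I_n -> nat) : Prop :=
  (forall i, (c i <= m)%N) /\ exists i, c i <> 0%N.

Definition pt (n : nat) (c : 'I_n -> nat) : 'I_n -> RR := fun i => (c i)%:R.

Definition origin (n : nat) : 'I_n -> RR := fun _ => 0.

Definition vanishes_grid (m n k : nat) (P : {mpoly RR[n]}) : Prop :=
  forall c : 'I_n -> nat, grid_nz m c -> mult_ge P (pt c) k.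

(* Main.v *)
Require Import Defs.
From HB Require Import structures.
From mathcomp Require Import all_boot all_order all_algebra.
From mathcomp Require Import ssrcomplements mpoly.
From mathcomp Require Import Rstruct.
From mathcomp Require Import ring lra zify.
Set Implicit Arguments. Unset Strict Implicit. Unset Printing Implicit Defensive.
Import Order.TTheory GRing.Theory Num.Theory.
Local Open Scope ring_scope.

(** Let Q(x) = x(x-1)...(x-m), e = Q/x and u = 1/e as a power series at 0. For an
    exponent b with |b| = k-1, the residues of P dx / prod_i Q(x_i)^(b_i+1) over the
    grid sum to zero as soon as deg P < mn + (m+1)(k-1). A zero of order k at each
    nonzero grid point cancels the pole there, so the residue at the origin alone
    vanishes: [x^b] P prod_i u(x_i)^(b_i+1) = 0. If P has order k-1 at the origin
    this reads P_b = 0 for all b, which gives (i). For (ii) the same argument applies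
    to x_j P for every j, and comparing the resulting relations for different j kills
    all coefficients of P of degree at most k-2 when k <= 4.

    For sharpness, every monomial of degree at least mn + (m+1)(k-1) is the top part
    of a product of the Q(x_i), x_i and e(x_i) with zeros of order k at the nonzero
    grid points and k-1 at the origin. Subtracting such products brings the degree of
    x_1^l prod_i e(x_i)^k below that bound without changing its order at the origin. *)

(** * Univariate residues *)

(** For monic [d] of degree [s + 1] this is the sum of the residues of [f * w / d] at the roots of
    [d], written without rational functions so that linearity is immediate. *)
Definition coef_modp (F : fieldType) (d w : {poly F}) (s : nat) (f : {poly F}) : F :=
  ((f * w) %% d)`_s.

Lemma coef_modp_is_linear (F : fieldType) (d w : {poly F}) (s : nat) :
  linear_for *%R (coef_modp d w s).
Proof.
by move=> c f g; rewrite /coef_modp mulrDl modpD coefD -scalerAl modpZl coefZ.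
Qed.

HB.instance Definition _ (F : fieldType) (d w : {poly F}) (s : nat) :=
  GRing.isLinear.Build F {poly F} F *%R (coef_modp d w s)
    (coef_modp_is_linear d w s).

Lemma coprimep_prodr (F : fieldType) (I : eqType) (r : seq I) (P : pred I)
    (q : I -> {poly F}) (p : {poly F}) :
  {in r, forall i, P i -> coprimep p (q i)} -> coprimep p (\prod_(i <- r | P i) q i).
Proof.
move=> h; rewrite big_seq_cond; apply: (big_ind (fun g => coprimep p g)).
- exact: coprimep1.
- by move=> f g hf hg; rewrite coprimepMr hf.
- by move=> i /andP[]; apply: h.
Qed.

Lemma prod_coprimep_dvdp (F : fieldType) (I : eqType) (r : seq I)
    (q : I -> {poly F}) (p : {poly F}) :
  uniq r -> (forall i j, i != j -> coprimep (q i) (q j)) ->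
  (forall i, q i %| p) -> \prod_(i <- r) q i %| p.
Proof.
move=> + cop dv; elim: r => [|i r IH] /=; first by rewrite big_nil dvd1p.
case/andP=> ir ur; rewrite big_cons Gauss_dvdp ?dv ?IH //.
rewrite coprimep_prodr // => j jr _; apply: cop.
by apply: contraNneq ir => ->.
Qed.

Lemma coef_monicM (R : nzRingType) (p r : {poly R}) (s b : nat) :
  p \is monic -> size p = s.+1 -> (size r <= b.+1)%N -> (p * r)`_(s + b) = r`_b.
Proof.
move=> pm ps rs.
have {1}-> : r = take_poly b r + (r`_b)%:P * 'X^b.
  apply/polyP => i; rewrite coefD coef_take_poly coefMXn coefC.
  case: (ltngtP i b) => ib; rewrite ?addr0 ?add0r //.
  - by rewrite subn_eq0 leqNgt ib nth_default // (leq_trans rs).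
  - by rewrite ib subnn eqxx.
rewrite mulrDr coefD mulrA coefMXn ltnNge leq_addl /= addnK coefMC.
have -> : p`_s = 1 by move/monicP: pm; rewrite lead_coefE ps.
rewrite mul1r nth_default ?add0r //.
apply: (leq_trans (size_polyMleq _ _)); rewrite ps addSn /= leq_add2l.
exact: size_take_poly.
Qed.

(* The residues at the nodes [x a] of [f dX / prod_a ('X - x a)^(b+1)]; they
   sum to zero when the degree of [f] leaves no residue at infinity. *)
Lemma sum_residues (F : fieldType) (m b : nat) (x : 'I_m.+1 -> F) (u : {poly F}) :
  injective x -> x ord0 = 0 ->
  'X^(b.+1) %| u * \prod_(i < m) ('X - (x (lift ord0 i))%:P) - 1 ->
  exists D : 'I_m.+1 -> {scalar {poly F}},
  [/\ forall a s f, (b < s)%N -> D a (('X - (x a)%:P) ^+ s * f) = 0,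
      forall f, D ord0 f = (f * u ^+ b.+1)`_b &
      forall f : {poly F}, (size f < m.+1 * b.+1)%N -> \sum_a D a f = 0].
Proof.
move=> xinj x0 hu.
pose q (a : 'I_m.+1) : {poly F} := ('X - (x a)%:P) ^+ b.+1.
pose N a := \prod_(i | i != a) q i.
pose Q := \prod_i q i.
have QE a : Q = q a * N a by rewrite /Q (bigD1 a).
have cop i j : i != j -> coprimep (q i) (q j).
  move=> ij; apply/coprimep_expl/coprimep_expr/coprimep_XsubC2.
  by rewrite subr_eq0 (inj_eq xinj) eq_sym.
have qmon a : q a \is monic by rewrite monic_exp // monicXsubC.
set e := \prod_(i < m) _ in hu.
have emon : e ^+ b.+1 \is monic by rewrite monic_exp // monic_prod_XsubC.
have es : size (e ^+ b.+1) = (m * b.+1).+1.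
  rewrite -(prednK (n := size _)) ?size_poly_gt0 ?monic_neq0 // size_exp.
  by rewrite size_prod_XsubC -[index_enum _]enumT size_enum_ord.
have q0 : q ord0 = 'X^(b.+1) by rewrite /q x0 subr0.
have N0 : N ord0 = e ^+ b.+1.
  apply: (mulfI (monic_neq0 (qmon ord0))).
  by rewrite -QE /Q big_ord_recl /e -prodrXl.
have sQ : size Q = (m.+1 * b.+1).+1.
  rewrite (QE ord0) N0 size_monicM ?monic_neq0 // q0 size_polyXn es; lia.
(* [N a * v a] is the Chinese remainder idempotent of the node [a]: 1 modulo [q a], 0 modulo the
   other [q i]. At the origin the inverse of [N a] is chosen as [u ^+ b.+1], so that the residue
   there is explicit. *)
have /fin_all_exists[v hv] : forall a : 'I_m.+1, exists v : {poly F},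
    q a %| N a * v - 1 /\ (a = ord0 -> v = u ^+ b.+1).
  move=> a; have [->|a0] := eqVneq a ord0.
    exists (u ^+ b.+1); split=> //; rewrite N0 q0 -exprMn.
    by rewrite (mulrC e) subrX1 dvdp_mulr.
  have /Bezout_eq1_coprimepP[[c d] /= cd] : coprimep (q a) (N a).
    by rewrite coprimep_prodr // => i _ ia; rewrite cop // eq_sym.
  exists d; split=> [|a00]; last by rewrite a00 eqxx in a0.
  by rewrite -cd mulrC addrC opprD addrNK -mulNr dvdp_mull.
(* The index is [deg Q - 1], the coefficient that carries the sum of residues. *)
exists (fun a => coef_modp Q (N a * v a) (m * b.+1 + b)); split.
- move=> a s f bs; rewrite /= /coef_modp modp_eq0 ?coef0 //.
  rewrite (QE a) mulrA dvdp_mulr // dvdp_mul // dvdp_mulr //.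
  exact: dvdp_exp2l.
- move=> f; rewrite /= /coef_modp (proj2 (hv _)) // (QE ord0) N0 q0.
  rewrite mulrCA [X in _ %% X]mulrC.
  set g := f * _.
  have -> : (e ^+ b.+1 * g) %% (e ^+ b.+1 * 'X^(b.+1)) = e ^+ b.+1 * (g %% 'X^(b.+1)).
    apply/esym/(modpP (q := g %/ 'X^(b.+1))).
      by rewrite {1}(divp_eq g ('X^(b.+1))); ring.
    rewrite (size_monicM emon (monic_neq0 (monicXn F (b.+1)))) size_polyXn addnS /=.
    have [->|nz] := eqVneq (g %% 'X^(b.+1)) 0.
      by rewrite mulr0 size_poly0 es.
    rewrite size_monicM // es addSn /= addSn ltnS leq_add2l -ltnS.
    have := ltn_modpN0 g (monic_neq0 (monicXn F (b.+1))); by rewrite size_polyXn.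
  rewrite -Pdiv.IdomainMonic.take_poly_modp.
  by rewrite (coef_monicM emon es (size_take_poly _ _)) coef_take_poly ltnSn.
- move=> f fs; rewrite /= /coef_modp -coef_sum.
  rewrite -(big_morph (fun g => g %% Q) (modpD Q) (mod0p Q)) -mulr_sumr.
  (* The idempotents sum to 1 modulo [Q], as each [q i] shows separately. The sum of the [D a f] is
     thus a coefficient of [f] itself, at an index beyond its degree. *)
  have /modp_eq0 h : Q %| \sum_a N a * v a - 1.
    apply: prod_coprimep_dvdp => // [|i]; first exact: index_enum_uniq.
    rewrite (bigD1 i) //= addrAC dvdp_add ?(proj1 (hv i)) //.
    apply: (big_ind (fun g => q i %| g)) => [||j ji]; first exact: dvdp0.
      by move=> g1 g2; apply: dvdp_add.
    rewrite dvdp_mulr // /N (bigD1 i) 1?eq_sym //=.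
    exact: dvdp_mulIl.
  rewrite -[\sum_a _](subrK 1) mulrDr mulr1 modpD -modp_mul h mulr0 mod0p add0r.
  rewrite modp_small; last by rewrite sQ; apply: leqW.
  rewrite nth_default //.
  by move: fs; rewrite mulSn addSn ltnS addnC.
Qed.

(** Up to a constant, the inverse is a product of geometric series [1 / (1 - X / j)] with positive
    coefficients. The resulting signs of [w]_1[and]w[_2] are what the later eliminations divide
    by. *)
Lemma truncated_inverse (F : realFieldType) (m K : nat) : (2 < K)%N ->
  exists (c : F) (w : {poly F}),
  [/\ c != 0,
      'X^K %| (c *: w) * \prod_(i < m) ('X - (i.+1%:R)%:P) - 1,
      w`_0 = 1,
      (0 < m)%N -> 0 < w`_1 &
      0 <= w`_1 /\ 0 <= w`_2].
Proof.
move=> K2; elim: m => [|m [c [w [c0 dv w0 w1 [w1' w2]]]]].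
  exists 1, 1; rewrite scale1r big_ord0 mul1r subrr dvdp0 oner_neq0 !coef1 /=.
  by split.
set a : F := m.+1%:R.
have a0 : 0 < a by rewrite ltr0n.
have ia0 : 0 < a^-1 by rewrite invr_gt0.
(* The series of [1 / (1 - X / a)] cut at order [K]; the cut costs only a multiple of ['X^K]. *)
pose g : {poly F} := \poly_(i < K) a^-1 ^+ i.
have gE i : (i < K)%N -> g`_i = a^-1 ^+ i by move=> iK; rewrite coef_poly iK.
have gM : ('X - a%:P) * g = - a *: (1 - (a^-1 *: 'X) ^+ K).
  rewrite -(opprB _ 1) subrX1 /g poly_def scalerN scaleNr opprK scalerAl.
  rewrite scalerBr scalerA divff ?gt_eqF // scale1r alg_polyC.
  by congr (_ * _); apply: eq_bigr => i _; rewrite exprZn.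
exists (- a^-1 * c), (w * g); split.
- by rewrite mulf_neq0 // oppr_eq0 gt_eqF.
- rewrite big_ord_recr /= -/a; set E := \prod_(i < m) _ in dv *.
  have -> : ((- a^-1 * c) *: (w * g)) * (E * ('X - a%:P)) - 1 =
    (c *: w * E - 1) - (c *: w * E) * (a^-1 *: 'X) ^+ K.
    have -> : ((- a^-1 * c) *: (w * g)) * (E * ('X - a%:P)) =
       (c *: w * E) * (- a^-1 *: (('X - a%:P) * g)).
      by rewrite -!mul_polyC polyCM; ring.
    rewrite gM scalerA mulrNN mulVf ?gt_eqF // scale1r; ring.
  by rewrite dvdp_sub // dvdp_mull // exprZn dvdpZr // expf_neq0 // gt_eqF.
- by rewrite coef0M w0 gE ?expr0 ?mul1r //; lia.
- move=> _; rewrite coefM !big_ord_recl big_ord0 /= w0 !gE; [|lia..].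
  by rewrite expr1 expr0 mul1r mulr1 addr0 ltr_pwDl.
- rewrite !coefM !big_ord_recl !big_ord0 /= w0 !gE; [|lia..].
  rewrite /bump /= !add1n !subn0 expr1 expr0 mul1r !mulr1 addr0.
  by split; rewrite !addr_ge0 ?mulr_ge0 ?exprn_ge0 // ltW.
Qed.

(** * Tensor products of univariate functionals *)

Definition tens (R : comNzRingType) (n : nat) (t : 'I_n -> {scalar {poly R}})
    (P : {mpoly R[n]}) : R :=
  \sum_(g <- msupp P) P@_g * \prod_i t i 'X^(g i).

(** Replaces the support, which varies with [P], by a fixed index set, so that linearity can be
    checked termwise. *)
Lemma tensE (R : comNzRingType) (n : nat) (t : 'I_n -> {scalar {poly R}})
    (P : {mpoly R[n]}) (d : nat) : (msize P <= d)%N ->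
  tens t P = \sum_(g : 'X_{1..n < d}) P@_g * \prod_i t i 'X^(g i).
Proof.
move=> hd; rewrite /tens (big_mksub ('X_{1..n < d})) ?msupp_uniq //=; last first.
  by move=> x /msize_mdeg_lt /leq_trans; apply.
rewrite big_rmcond //= => j /memN_msupp_eq0 ->.
by rewrite mul0r.
Qed.

Lemma tens_is_linear (R : comNzRingType) (n : nat) (t : 'I_n -> {scalar {poly R}}) :
  linear_for *%R (tens t).
Proof.
move=> c P Q; pose d := maxn (msize (c *: P + Q)) (maxn (msize P) (msize Q)).
rewrite !(@tensE _ _ _ _ d) ?leq_max ?leqnn ?orbT //.
rewrite mulr_sumr -big_split /=; apply: eq_bigr => g _.
by rewrite mcoeffD mcoeffZ mulrDl mulrA.
Qed.

HB.instance Definition _ (R : comNzRingType) (n : nat) (t : 'I_n -> {scalar {poly R}}) :=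
  GRing.isLinear.Build R {mpoly R[n]} R *%R (tens t) (tens_is_linear t).

Lemma tensX (R : comNzRingType) (n : nat) (t : 'I_n -> {scalar {poly R}}) g :
  tens t 'X_[g] = \prod_i t i 'X^(g i).
Proof. by rewrite /tens msuppX big_seq1 mcoeffX eqxx mul1r. Qed.

Lemma tens_prod (R : comNzRingType) (n : nat) (t : 'I_n -> {scalar {poly R}})
    (f : 'I_n -> {poly R}) :
  tens t (\prod_i horner_alg ('X_i : {mpoly R[n]}) (f i)) = \prod_i t i (f i).
Proof.
pose d := \max_i size (f i).
have fE i : f i = \sum_(s < d) (f i)`_s *: 'X^s.
  apply/polyP => s; rewrite coef_sum.
  under eq_bigr => j _ do rewrite coefZ coefXn.
  have [sd|ds] := ltnP s d.
    rewrite (bigD1 (Ordinal sd)) //= eqxx mulr1 big1 ?addr0 // => j js.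
    rewrite (_ : (s == j) = false) ?mulr0 //; apply/negbTE.
    by apply: contraNneq js => sj; apply/eqP/val_inj.
  rewrite nth_default; last by apply: leq_trans ds; apply: leq_bigmax.
  rewrite big1 // => j _; rewrite (_ : (s == j) = false) ?mulr0 //.
  by apply: gtn_eqF; apply: leq_trans (ltn_ord j) ds.
have hE i : horner_alg ('X_i : {mpoly R[n]}) (f i) = \sum_(s < d) (f i)`_s *: 'X_i ^+ s.
  rewrite {1}[f i]fE linear_sum; apply: eq_bigr => s _.
  by rewrite linearZ /= rmorphXn /= horner_algX mulr_algl.
under eq_bigr => i _ do rewrite hE.
rewrite bigA_distr_bigA linear_sum /=.
under [RHS]eq_bigr => i _ do rewrite [f i]fE linear_sum.
rewrite bigA_distr_bigA; apply: eq_bigr => h _ /=.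
have -> : \prod_i ((f i)`_(h i) *: 'X_i ^+ h i) =
   (\prod_i (f i)`_(h i)) *: 'X_[[multinom (h i : nat) | i < n]] :> {mpoly R[n]}.
  rewrite scaler_prod mpolyXE_id; congr (_ *: _).
  by apply: eq_bigr => i _; rewrite mnmE.
rewrite linearZ /= tensX -big_split /=.
by apply: eq_bigr => i _; rewrite linearZ mnmE.
Qed.

(** * Residues on the grid *)

Lemma shift_mpolyK (n : nat) (P : {mpoly RR[n]}) (a : 'I_n -> RR) :
  shift_mpoly P a \mPo [tuple ('X_i - (a i)%:MP) | i < n] = P.
Proof.
rewrite [in RHS](mpolyE P) /shift_mpoly (comp_mpolyEX P) linear_sum /=; apply: eq_bigr => g _.
rewrite linearZ /= comp_mpolyX rmorph_prod mpolyXE_id; congr (_ *: _).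
apply: eq_bigr => i _; rewrite rmorphXn /= tnth_mktuple rmorphD /=.
by rewrite comp_mpolyXU comp_mpolyC -tnth_nth tnth_mktuple subrK.
Qed.

(** Taylor expansion at [a]: this is how the multiplicity of [P] at [a] enters the residues. *)
Lemma tens_shift (n : nat) (t : 'I_n -> {scalar {poly RR}}) (P : {mpoly RR[n]})
    (a : 'I_n -> RR) :
  tens t P = \sum_(g <- msupp (shift_mpoly P a))
    (shift_mpoly P a)@_g * \prod_i t i (('X - (a i)%:P) ^+ g i).
Proof.
rewrite -{1}(shift_mpolyK P a) comp_mpolyE linear_sum; apply: eq_bigr => g _.
rewrite linearZ /=; congr (_ * _); rewrite -tens_prod; congr (tens t _).
apply: eq_bigr => i _; rewrite tnth_mktuple rmorphXn rmorphB /= horner_algX horner_algC.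
by rewrite alg_mpolyC.
Qed.

Lemma mdeg_lt_ex (n : nat) (b g : 'X_{1..n}) :
  (mdeg b < mdeg g)%N -> exists i, (b i < g i)%N.
Proof.
move=> bg; apply/existsP; apply: contraLR bg; rewrite negb_exists => /forallP h.
by rewrite -leqNgt !mdegE; apply: leq_sum => i _; rewrite leqNgt.
Qed.

(* The multivariate residue theorem on the grid: away from the origin the poles
   are cancelled by the zeros of [P], so the residue at the origin vanishes. *)
Lemma jet_relation (m n k : nat) (P : {mpoly RR[n]}) (b : 'X_{1..n}) (u : {poly RR}) :
  vanishes_grid m k P -> (mdeg b < k)%N ->
  (msize P <= m * n + m.+1 * mdeg b)%N ->
  'X^k %| u * \prod_(i < m) ('X - (i.+1%:R)%:P) - 1 ->
  \sum_(g <- msupp P) P@_g * \prod_i ('X^(g i) * u ^+ (b i).+1)`_(b i) = 0.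
Proof.
move=> van bk degP hu.
pose x (a : 'I_m.+1) : RR := a%:R.
have xinj : injective x by move=> i j /eqP; rewrite eqr_nat => /eqP/val_inj.
have /fin_all_exists[D hD] : forall i : 'I_n, exists D : 'I_m.+1 -> {scalar {poly RR}},
  [/\ forall a s f, (b i < s)%N -> D a (('X - (x a)%:P) ^+ s * f) = 0,
      forall f, D ord0 f = (f * u ^+ (b i).+1)`_(b i) &
      forall f : {poly RR}, (size f < m.+1 * (b i).+1)%N -> \sum_a D a f = 0].
  move=> i; apply: sum_residues => //; apply: dvdp_trans hu; apply: dvdp_exp2l.
  by apply: leq_ltn_trans bk; rewrite mdegE (bigD1 i) //= leq_addr.
have sumD : \sum_(h : {ffun 'I_n -> 'I_m.+1}) tens (fun i => D i (h i)) P = 0.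
  rewrite /tens exchange_big big_seq big1 //= => g gP.
  rewrite -mulr_sumr -(bigA_distr_bigA (fun i a => D i a 'X^(g i))).
  (* The sum over [h] factors into univariate residue sums, so one vanishing factor is enough. It
     exists by pigeonhole: these thresholds add up to [m * n + m.+1 * mdeg b], which exceeds
     [mdeg g]. *)
  suff [i hi] : exists i, (g i < m.+1 * (b i).+1 - 1)%N.
    rewrite (bigD1 i) //= (let: And3 _ _ h := hD i in h) ?mul0r ?mulr0 //.
    by rewrite size_polyXn; lia.
  apply/existsP; apply: contraLR (msize_mdeg_lt gP).
  rewrite negb_exists => /forallP h; rewrite -leqNgt (leq_trans degP) // [mdeg g]mdegE.
  have -> : (m * n + m.+1 * mdeg b = \sum_(i < n) (m.+1 * (b i).+1 - 1))%N.
    rewrite mdegE big_distrr /= mulnC -{1}(card_ord n) -sum_nat_const -big_split /=.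
    by apply: eq_bigr => i _; rewrite mulnS subn1.
  by apply: leq_sum => i _; rewrite leqNgt.
move: sumD; rewrite (bigD1 [ffun=> ord0]) //= big1 ?addr0 => [|h h0].
  rewrite /tens => hs; rewrite -[RHS]hs; apply: eq_bigr => g _; congr (_ * _).
  by apply: eq_bigr => i _; rewrite ffunE (let: And3 _ h _ := hD i in h).
(* At a nonzero grid point every Taylor exponent has degree at least [k > mdeg b], hence exceeds [b]
   in some coordinate [i], and [D i (h i)] kills that power. *)
rewrite (tens_shift _ _ (pt (fun i => h i))) big_seq big1 // => g gP.
have [|i bg] := @mdeg_lt_ex _ b g.
  apply: (leq_trans bk); apply: van gP; split=> [i|]; first by rewrite -ltnS.
  have /existsP[i hi] : [exists i, h i != ord0].
    apply: contraR h0; rewrite negb_exists => /forallP h0.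
    by apply/eqP/ffunP => i; rewrite ffunE; apply/eqP; have := h0 i; rewrite negbK.
  by exists i => hi0; case/eqP: hi; apply: val_inj.
rewrite (bigD1 i) //= -[_ ^+ g i]mulr1.
by rewrite (let: And3 h _ _ := hD i in h) // mul0r mulr0.
Qed.

(** * Explicit relations between low-order coefficients at the origin *)

Lemma coef0_exp1 (R : nzRingType) (w : {poly R}) (r : nat) : w`_0 = 1 -> (w ^+ r)`_0 = 1.
Proof.
by move=> w0; elim: r => [|r IH]; rewrite ?expr0 ?coef1 // exprS coef0M IH w0 mulr1.
Qed.

Lemma coef1_exp1 (R : comNzRingType) (w : {poly R}) (r : nat) :
  w`_0 = 1 -> (w ^+ r)`_1 = r%:R * w`_1.
Proof.
move=> w0; elim: r => [|r IH]; first by rewrite expr0 coef1 mul0r.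
rewrite exprS coefM !big_ord_recl big_ord0 /= /bump /= w0 IH (coef0_exp1 _ w0) -natr1.
by ring.
Qed.

Lemma coef2_exp1 (R : comNzRingType) (w : {poly R}) (r : nat) :
  w`_0 = 1 -> (w ^+ r)`_2 = r%:R * w`_2 + 'C(r, 2)%:R * w`_1 ^+ 2.
Proof.
move=> w0; elim: r => [|r IH]; first by rewrite expr0 coef1 bin0n !mul0r addr0.
rewrite exprS coefM !big_ord_recl big_ord0 /= /bump /= w0 IH.
rewrite !subSS subn0 (coef0_exp1 _ w0) (coef1_exp1 _ w0) binS bin1 natrD -natr1.
by ring.
Qed.

(* The coefficient of ['X_[b]] in ['X_[g] * prod_i w('X_i)^(c_i + 1)]. *)
Definition jet_weight (n : nat) (w : {poly RR}) (b c g : 'X_{1..n}) : RR :=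
  \prod_i ('X^(g i) * w ^+ (c i).+1)`_(b i).

(** The constant [c] of the inverse enters each term through the same nonzero factor, a power of [c]
    depending only on [b], and cancels. One [w] serves all [n], [P] and [b]. *)
Lemma jet_relation_normalized (m k : nat) : (0 < m)%N ->
  exists w : {poly RR}, [/\ w`_0 = 1, 0 < w`_1, 0 <= w`_2 &
    forall (n : nat) (P : {mpoly RR[n]}) (b : 'X_{1..n}),
    vanishes_grid m k P -> (mdeg b < k)%N ->
    (msize P <= m * n + m.+1 * mdeg b)%N ->
    \sum_(g <- msupp P) P@_g * jet_weight w b b g = 0].
Proof.
(* Precision at least 3 keeps the coefficients of index 1 and 2, whose signs are needed even for
   [k = 2]. *)
move=> m0; have [|c [w [c0 dv w0 w1 [_ w2]]]] := @truncated_inverse RR m (maxn k 3).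
  by rewrite leq_max orbT.
exists w; split=> //; first exact: w1.
move=> n P b van bk degP.
have hc : \prod_(i < n) c ^+ (b i).+1 != 0.
  by apply/prodf_neq0 => i _; rewrite expf_neq0.
apply: (mulfI hc); rewrite mulr0.
have {}dv : 'X^k %| (c *: w) * \prod_(i < m) ('X - (i.+1%:R)%:P) - 1.
  by apply: dvdp_trans dv; rewrite dvdp_exp2l // leq_maxl.
rewrite -[RHS](jet_relation van bk degP dv) mulr_sumr; apply: eq_bigr => g _.
rewrite mulrCA -big_split /=; congr (_ * _); apply: eq_bigr => i _.
by rewrite exprZn -scalerAr coefZ.
Qed.

(** The shift by [U_(j)] cancels between monomial and extracted coefficient; only the power of [w]
    in the variable [j] remembers it. Varying [j] thus gives different relations between the same
    coefficients of [P]. *)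
Lemma jet_relationMX (n : nat) (P : {mpoly RR[n]}) (w : {poly RR}) (b : 'X_{1..n}) (j : 'I_n) :
  \sum_(g <- msupp (P * 'X_j)) (P * 'X_j)@_g * jet_weight w (b + U_(j)) (b + U_(j)) g =
  \sum_(g <- msupp P) P@_g * jet_weight w b (b + U_(j)) g.
Proof.
rewrite (perm_big _ (msuppMX _ _)) big_map; apply: eq_bigr => g _ /=.
rewrite mcoeffMX; congr (_ * _); apply: eq_bigr => i _.
by rewrite !mnmDE [(_ + g i)%N]addnC !coefXnM ltn_add2r subnDr.
Qed.

Lemma jet_weight_neq0 (n : nat) (w : {poly RR}) (b c g : 'X_{1..n}) :
  jet_weight w b c g != 0 -> forall i, (g i <= b i)%N.
Proof.
move=> /prodf_neq0 h i; have := h i isT; rewrite coefXnM.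
by case: ltnP => //; rewrite eqxx.
Qed.

Lemma sum_msupp_restrict (n : nat) (R : nzRingType) (P : {mpoly R[n]}) (G : 'X_{1..n} -> R)
    (s : seq 'X_{1..n}) :
  uniq s -> (forall g, g \in msupp P -> G g != 0 -> g \in s) ->
  \sum_(g <- msupp P) P@_g * G g = \sum_(g <- s) P@_g * G g.
Proof.
move=> us hs.
rewrite (bigID (fun g => g \in s)) /= [X in _ + X]big1_seq ?addr0; last first.
  move=> g /andP[gs gP]; have [->|/(hs _ gP) gs'] := eqVneq (G g) 0; first by rewrite mulr0.
  by rewrite gs' in gs.
rewrite [RHS](bigID (fun g => g \in msupp P)) /= [X in _ = _ + X]big1 ?addr0; last first.
  by move=> g /memN_msupp_eq0 ->; rewrite mul0r.
rewrite -big_filter -[RHS]big_filter; apply: perm_big.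
apply: uniq_perm; rewrite ?filter_uniq ?msupp_uniq // => g.
by rewrite !mem_filter andbC.
Qed.

Lemma jet_weight_on (n : nat) (w : {poly RR}) (b c g : 'X_{1..n}) (A : {pred 'I_n}) :
  w`_0 = 1 -> (forall i, i \notin A -> g i = b i) ->
  jet_weight w b c g = \prod_(i in A) ('X^(g i) * w ^+ (c i).+1)`_(b i).
Proof.
move=> w0 h; rewrite /jet_weight (bigID (fun i => i \in A)) /= [X in _ * X]big1 ?mulr1 //.
by move=> i iA; rewrite h // coefXnM ltnn subnn coef0_exp1.
Qed.

Lemma jet_weight1 (n : nat) (w : {poly RR}) (b c g : 'X_{1..n}) (i : 'I_n) :
  w`_0 = 1 -> (forall t, t != i -> g t = b t) ->
  jet_weight w b c g = ('X^(g i) * w ^+ (c i).+1)`_(b i).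
Proof.
by move=> w0 h; rewrite (@jet_weight_on _ _ _ _ _ (pred1 i)) // (big_pred1 i).
Qed.

Lemma jet_weight2 (n : nat) (w : {poly RR}) (b c g : 'X_{1..n}) (i l : 'I_n) :
  w`_0 = 1 -> i != l -> (forall t, t != i -> t != l -> g t = b t) ->
  jet_weight w b c g =
  ('X^(g i) * w ^+ (c i).+1)`_(b i) * ('X^(g l) * w ^+ (c l).+1)`_(b l).
Proof.
move=> w0 il h; rewrite (@jet_weight_on _ _ _ _ _ (pred2 i l)) //; last first.
  by move=> t; rewrite inE negb_or => /andP[]; apply: h.
rewrite (bigD1 i) ?inE ?eqxx //= (bigD1 l) ?inE ?eqxx ?orbT 1?eq_sym //= big1 ?mulr1 //.
by move=> t; rewrite !inE; case: (t == i); case: (t == l).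
Qed.

(** Only exponents below [b] coordinatewise have nonzero weight. Those other than [b] have smaller
    degree and vanish, and [b] itself has weight 1. *)
Lemma low_jet_top (n : nat) (P : {mpoly RR[n]}) (w : {poly RR}) (b c : 'X_{1..n}) :
  w`_0 = 1 -> \sum_(g <- msupp P) P@_g * jet_weight w b c g = 0 ->
  (forall g, (mdeg g < mdeg b)%N -> P@_g = 0) -> P@_b = 0.
Proof.
move=> w0 + low; rewrite (@sum_msupp_restrict _ _ _ _ [:: b]) //.
  by rewrite big_seq1 (@jet_weight_on _ _ _ _ _ pred0) // big_pred0_eq mulr1.
move=> g gP /jet_weight_neq0 gb; rewrite inE; apply/eqP/mnmP => i.
apply/eqP; rewrite eqn_leq gb /= leqNgt; apply/negP => gbi.
move: gP; rewrite mcoeff_msupp low ?eqxx //.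
rewrite !mdegE (bigD1 i) //= [X in (_ < X)%N](bigD1 i) //= -addSn.
by rewrite leq_add // leq_sum.
Qed.

(** Only divisors of the monomial contribute, and [j] is visible only in whether the power of [w] at
    [i] is 2 or 3. *)
Lemma sum_jet_U (n : nat) (P : {mpoly RR[n]}) (w : {poly RR}) (i j : 'I_n) :
  w`_0 = 1 ->
  \sum_(g <- msupp P) P@_g * jet_weight w U_(i) (U_(i) + U_(j)) g =
  P@_U_(i) + (2 + (j == i))%:R * w`_1 * P@_0.
Proof.
move=> w0; rewrite (@sum_msupp_restrict _ _ _ _ [:: U_(i); 0]%MM) /=.
- rewrite !big_cons big_nil !(@jet_weight1 _ _ _ _ _ i) //; last first.
    by move=> l; rewrite mnm0E mnm1E eq_sym => /negPf ->.
  rewrite !mnmDE !mnm1E mnm0E eqxx !coefXnM /= !subnn subn0.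
  by rewrite coef0_exp1 // coef1_exp1 //= mulr1 addr0 mulrC.
- by rewrite inE mnm1_eq0.
move=> g _ /jet_weight_neq0 gb; rewrite !inE.
have [gi|gi] := posnP (g i).
  apply/orP; right; apply/eqP/mnmP => l; have := gb l; rewrite mnm0E mnm1E.
  by case: eqVneq => [<-|_]; lia.
apply/orP; left; apply/eqP/mnmP => l; have := gb l; rewrite mnm1E.
by case: eqVneq => [<-|_]; lia.
Qed.

Lemma sum_jet_2U (n : nat) (P : {mpoly RR[n]}) (w : {poly RR}) (i j : 'I_n) :
  w`_0 = 1 ->
  let r := (3 + (j == i))%N in
  \sum_(g <- msupp P) P@_g * jet_weight w (U_(i) *+ 2) (U_(i) *+ 2 + U_(j)) g =
  P@_(U_(i) *+ 2) + r%:R * w`_1 * P@_U_(i) + (r%:R * w`_2 + 'C(r, 2)%:R * w`_1 ^+ 2) * P@_0.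
Proof.
move=> w0 r; rewrite (@sum_msupp_restrict _ _ _ _ [:: U_(i) *+ 2; U_(i); 0]%MM) /=.
- have h t : t != i -> (U_(i) : 'X_{1..n})%MM t = 0%N by rewrite mnm1E eq_sym => /negPf ->.
  rewrite !big_cons big_nil !(@jet_weight1 _ _ _ _ _ i) //;
    try by move=> t ti; rewrite ?mulmnE ?mnm0E h.
  have e1 : (U_(i) *+ 2 : 'X_{1..n})%MM i = 2%N by rewrite mulmnE mnm1E eqxx.
  rewrite [((_ + _)%MM i)]mnmDE e1 !mnm1E mnm0E eqxx !coefXnM /= subnn subn0.
  rewrite coef0_exp1 // coef1_exp1 // coef2_exp1 // mulr1 addr0 add2n -/r.
  by rewrite addrA [_ * P@_U_(i)]mulrC [_ * P@_0]mulrC.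
- rewrite !inE mnm1_eq0 /= andbT negb_or.
  by apply/andP; split; apply/eqP => /mnmP/(_ i); rewrite ?mulmnE ?mnmDE !mnm1E ?mnm0E eqxx.
move=> g _ /jet_weight_neq0 gb; rewrite !inE.
have gE : g = (U_(i) *+ (g i))%MM.
  apply/mnmP => l; have := gb l; rewrite !mulmnE mnm1E.
  by case: eqVneq => [<-|_]; lia.
have := gb i; rewrite mulmnE mnm1E eqxx mul1n gE mulmnE mnm1E eqxx mul1n.
by case: (g i) => [|[|[|]]] // _; rewrite ?mulm0n ?mulm1n eqxx ?orbT.
Qed.

Lemma sum_jet_UU (n : nat) (P : {mpoly RR[n]}) (w : {poly RR}) (i l j : 'I_n) :
  w`_0 = 1 -> i != l ->
  let ri := (2 + (j == i))%N in let rl := (2 + (j == l))%N in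
  \sum_(g <- msupp P) P@_g * jet_weight w (U_(i) + U_(l)) (U_(i) + U_(l) + U_(j)) g =
  P@_(U_(i) + U_(l)) + rl%:R * w`_1 * P@_U_(i) + ri%:R * w`_1 * P@_U_(l) +
  ri%:R * rl%:R * w`_1 ^+ 2 * P@_0.
Proof.
move=> w0 il ri rl.
have li : (l == i) = false by rewrite eq_sym (negPf il).
rewrite (@sum_msupp_restrict _ _ _ _ [:: U_(i) + U_(l); U_(i); U_(l); 0]%MM) /=.
- have h t : t != i -> t != l -> (U_(i) : 'X_{1..n})%MM t = 0%N /\ (U_(l) : 'X_{1..n})%MM t = 0%N.
    by rewrite !mnm1E ![t == _]eq_sym => /negPf -> /negPf ->.
  rewrite !big_cons big_nil !(@jet_weight2 _ _ _ _ _ i l) //;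
    try by move=> t ti tl; have [hi hl] := h t ti tl; rewrite ?mnmDE ?mnm0E ?hi ?hl.
  rewrite !mnmDE !mnm1E !mnm0E !eqxx li (negPf il) !coefXnM /= !subnn !subn0.
  rewrite !coef0_exp1 // !coef1_exp1 // !mulr1 ?addn0 ?add0n ?add1n.
  rewrite -[(j == i).+2]/ri -[(j == l).+2]/rl.
  by clearbody ri rl; ring.
- rewrite !inE !negb_or !mnm1_eq0 /= !andbT.
  by repeat (apply/andP; split); apply/eqP => /mnmP h; have := h i; have := h l;
    rewrite ?mnmDE ?mnm1E ?mnm0E !eqxx ?li ?(negPf il).
move=> g _ /jet_weight_neq0 gb; rewrite !inE.
have gE : g = (U_(i) *+ (g i) + U_(l) *+ (g l))%MM.
  apply/mnmP => t; have := gb t; rewrite !mnmDE !mulmnE !mnm1E.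
  case: (eqVneq i t) => [it|_]; case: (eqVneq l t) => [lt|_]; rewrite ?it ?lt; last by lia.
  - by rewrite it lt eqxx in il.
  - by lia.
  - by lia.
have gi : (g i <= 1)%N by have := gb i; rewrite mnmDE !mnm1E eqxx li.
have gl : (g l <= 1)%N by have := gb l; rewrite mnmDE !mnm1E eqxx (negPf il).
rewrite gE; move: (g i) (g l) gi gl => [|[|]] // [|[|]] // _ _;
  by rewrite ?mulm0n ?mulm1n ?addm0 ?add0m eqxx ?orbT.
Qed.

(** * Multiplicities and lower bounds *)

Lemma shift_mpoly_origin (n : nat) (P : {mpoly RR[n]}) : shift_mpoly P (@origin n) = P.
Proof.
rewrite -[RHS]comp_mpoly_id /shift_mpoly; congr (P \mPo _).
by apply: eq_from_tnth => i; rewrite !tnth_mktuple mpolyC0 addr0.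
Qed.

Lemma mult_ge0 (n : nat) (P : {mpoly RR[n]}) (a : 'I_n -> RR) : mult_ge P a 0.
Proof. by []. Qed.

Lemma mult_ge_leq (n : nat) (P : {mpoly RR[n]}) (a : 'I_n -> RR) (k l : nat) :
  (k <= l)%N -> mult_ge P a l -> mult_ge P a k.
Proof. by move=> kl h g /h; apply: leq_trans. Qed.

Lemma mult_geD (n : nat) (P Q : {mpoly RR[n]}) (a : 'I_n -> RR) (k : nat) :
  mult_ge P a k -> mult_ge Q a k -> mult_ge (P + Q) a k.
Proof.
move=> hP hQ g; rewrite /shift_mpoly rmorphD => /msuppD_le.
by rewrite mem_cat => /orP[/hP|/hQ].
Qed.

Lemma mult_geZ (n : nat) (c : RR) (P : {mpoly RR[n]}) (a : 'I_n -> RR) (k : nat) :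
  mult_ge P a k -> mult_ge (c *: P) a k.
Proof. by move=> hP g; rewrite /shift_mpoly linearZ => /msuppZ_le/hP. Qed.

Lemma mult_geM (n : nat) (P Q : {mpoly RR[n]}) (a : 'I_n -> RR) (k l : nat) :
  mult_ge P a k -> mult_ge Q a l -> mult_ge (P * Q) a (k + l).
Proof.
move=> hP hQ g; rewrite /shift_mpoly rmorphM => /msuppM_le/allpairsP[[g1 g2] /= [h1 h2 ->]].
by rewrite mdegD leq_add // ?(hP _ h1) ?(hQ _ h2).
Qed.

Lemma mult_geX (n : nat) (P : {mpoly RR[n]}) (a : 'I_n -> RR) (k r : nat) :
  mult_ge P a k -> mult_ge (P ^+ r) a (r * k).
Proof.
move=> hP; elim: r => [|r IH]; first exact: mult_ge0.
by rewrite exprS mulSn; apply: mult_geM.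
Qed.

Lemma mult_ge_prod (n : nat) (I : finType) (f : I -> {mpoly RR[n]}) (a : 'I_n -> RR)
    (k : I -> nat) :
  (forall i, mult_ge (f i) a (k i)) -> mult_ge (\prod_i f i) a (\sum_i k i).
Proof.
move=> h; elim/big_rec2: _ => [|i x y _ IH]; first exact: mult_ge0.
by apply: mult_geM.
Qed.

Lemma leq_tdeg_bound (n : nat) (P : {mpoly RR[n]}) (d : nat) :
  (tdeg P < d)%N = (msize P <= d)%N && (0 < d)%N.
Proof. by rewrite /tdeg; move: (msize P) => s; lia. Qed.

Lemma msizeMX_le (n : nat) (P : {mpoly RR[n]}) (j : 'I_n) :
  (msize (P * 'X_j) <= (msize P).+1)%N.
Proof.
have [->|P0] := eqVneq P 0; first by rewrite mul0r msize0.
rewrite msizeM //; first by rewrite msizeX mdeg1 addn2.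
by rewrite -msize_poly_eq0 msizeX.
Qed.

Lemma degree_bound_top (m n k : nat) (P : {mpoly RR[n]}) : (0 < m)%N -> (0 < k)%N ->
  vanishes_grid m k P -> mult_eq P (@origin n) (k - 1) ->
  (m * n + m.+1 * (k - 1) <= tdeg P)%N.
Proof.
move=> m0 k0 van [lo hi]; rewrite leqNgt leq_tdeg_bound; apply/negP => /andP[degP _].
have [w [w0 _ _ rel]] := @jet_relation_normalized m k m0.
apply: hi => g gP; rewrite shift_mpoly_origin in gP.
have lo' h : h \in msupp P -> (k - 1 <= mdeg h)%N.
  by move=> hP; apply: lo; rewrite shift_mpoly_origin.
rewrite ltn_neqAle lo' // andbT; apply/eqP => gk.
move: (gP); rewrite mcoeff_msupp (@low_jet_top _ _ w g g) ?eqxx //.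
  by apply: rel => //; rewrite -gk //; lia.
move=> h hg; apply: memN_msupp_eq0; apply/negP => /lo'; lia.
Qed.

(* Comparing the relations for different [j] kills the coefficients degree by degree;
   [k - 1 <= n] provides the distinct indices that this needs. *)
Lemma low_jet_eq0 (n k : nat) (P : {mpoly RR[n]}) (w : {poly RR}) :
  w`_0 = 1 -> 0 < w`_1 -> 0 <= w`_2 -> k \in [:: 2; 3; 4]%N -> (k - 1 <= n)%N ->
  (forall (b : 'X_{1..n}) (j : 'I_n), mdeg b = (k - 2)%N ->
     \sum_(g <- msupp P) P@_g * jet_weight w b (b + U_(j)) g = 0) ->
  forall g, (mdeg g <= k - 2)%N -> P@_g = 0.
Proof.
move=> w0 w1 w2 hk hn rel.
have n0 : (0 < n)%N by move: hk hn; rewrite !inE => /or3P[] /eqP ->; lia.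
have top : (forall g, (mdeg g < k - 2)%N -> P@_g = 0) ->
    forall g, (mdeg g <= k - 2)%N -> P@_g = 0.
  move=> low g; rewrite leq_eqVlt => /orP[/eqP gk|]; last exact: low.
  by apply: (low_jet_top w0 (rel g (Ordinal n0) gk)); rewrite gk.
apply: top; move: hk hn rel; rewrite !inE => /or3P[] /eqP -> hn rel g.
- by [].
- rewrite ltnS leqn0 mdeg_eq0 => /eqP ->.
  pose i0 := Ordinal n0; pose i1 := Ordinal hn.
  have := rel U_(i0)%MM i0 (mdeg1 _); have := rel U_(i0)%MM i1 (mdeg1 _).
  rewrite !sum_jet_U // => e1 e2.
  have /eqP : w`_1 * P@_0 = 0 by rewrite /= in e1 e2; lra.
  by rewrite mulf_eq0 gt_eqF //= => /eqP.
pose i0 := Ordinal n0; pose i2 := Ordinal hn.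
have n1 : (1 < n)%N by lia.
pose i1 := Ordinal n1.
(* Case [k = 4]. With [b = U_(i0) + U_(i1)], passing from [j = i2] to [j = i0] gives
   [w1 * P_1 + 2 * w1^2 * P_0 = 0]. With [b = U_(i1) *+ 2], passing from [j = i0] to [j = i1] gives
   [w1 * P_1 + (w2 + 3 * w1^2) * P_0 = 0]. Subtracting leaves [(w2 + w1^2) * P_0 = 0] with a
   positive factor. *)
have p0 : P@_0 = 0.
  have d2 i : mdeg (U_(i) *+ 2 : 'X_{1..n})%MM = (4 - 2)%N by rewrite mdegMn mdeg1.
  have d11 i l : mdeg (U_(i) + U_(l) : 'X_{1..n})%MM = (4 - 2)%N by rewrite mdegD !mdeg1.
  have := rel _ i0 (d2 i1); have := rel _ i1 (d2 i1).
  have := rel _ i2 (d11 i0 i1); have := rel _ i0 (d11 i0 i1).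
  rewrite !sum_jet_2U // !sum_jet_UU //= => e1 e2 e3 e4.
  have /eqP : (w`_2 + w`_1 ^+ 2) * P@_0 = 0.
    rewrite (_ : 'C(3 + 1, 2) = 6%N) // in e3; rewrite (_ : 'C(3 + 0, 2) = 3%N) // in e4.
    by rewrite !natrD in e1 e2 e3 e4; lra.
  rewrite mulf_eq0 gt_eqF => [/eqP //|].
  by rewrite ltr_wpDl // exprn_gt0.
rewrite ltnS leq_eqVlt ltnS leqn0 mdeg_eq0 => /orP[/mdeg1P[i /eqP ->]|/eqP -> //].
have [l il] : exists l, l != i.
  by case: (eqVneq i i0) => [->|ii0]; [exists i1 | exists i0; rewrite eq_sym].
have d2 : mdeg (U_(i) *+ 2 : 'X_{1..n})%MM = (4 - 2)%N by rewrite mdegMn mdeg1.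
have := rel _ i d2; have := rel _ l d2; rewrite !sum_jet_2U // p0 eqxx (negPf il) => e1 e2.
have /eqP : w`_1 * P@_U_(i) = 0 by rewrite /= in e1 e2; lra.
by rewrite mulf_eq0 gt_eqF //= => /eqP.
Qed.

Lemma degree_bound_low (m n k l : nat) (P : {mpoly RR[n]}) : (0 < m)%N ->
  vanishes_grid m k P -> mult_eq P (@origin n) l ->
  (l <= k - 2)%N -> k \in [:: 2; 3; 4]%N -> (k - 1 <= n)%N ->
  (m * n + m.+1 * (k - 1) - 1 <= tdeg P)%N.
Proof.
move=> m0 van [_ hi] lk hk hn; rewrite leqNgt leq_tdeg_bound; apply/negP => /andP[degP D0].
have k2 : (2 <= k)%N by move: hk; rewrite !inE => /or3P[] /eqP ->.
have [w [w0 w1 w2 rel]] := @jet_relation_normalized m k m0.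
apply: hi => g; rewrite shift_mpoly_origin mcoeff_msupp.
apply: contraR; rewrite -leqNgt => gl.
apply/eqP; apply: (low_jet_eq0 w0 w1 w2 hk hn); last by lia.
(* The factor ['X_j] costs one degree, which is the [- 1] in the bound, and lifts [b] from degree
   [k - 2] to [k - 1]. *)
move=> b j bk; rewrite -jet_relationMX; apply: rel.
- by move=> c hc; rewrite -[k]addn0; apply: mult_geM; [exact: van|exact: mult_ge0].
- by rewrite mdegD mdeg1; lia.
rewrite mdegD mdeg1 bk (leq_trans (msizeMX_le _ _)) //.
rewrite (_ : (k - 2 + 1 = k - 1)%N); last by lia.
by move: degP D0; move: (msize P) (m * n + _)%N => s D; lia.
Qed.

(** * Extremal polynomials *)

(** As [msize] is the degree plus one, the difference has degree below [mdeg g]: the top homogeneous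
    part of [P] is the single monomial ['X_[g]]. *)
Definition has_top (n : nat) (P : {mpoly RR[n]}) (g : 'X_{1..n}) : Prop :=
  (msize (P - 'X_[g]) <= mdeg g)%N.

Lemma msizeM_leq (n : nat) (P Q : {mpoly RR[n]}) (a b : nat) :
  (msize P <= a.+1)%N -> (msize Q <= b)%N -> (msize (P * Q) <= a + b)%N.
Proof.
move=> hP hQ.
have [->|P0] := eqVneq P 0; first by rewrite mul0r msize0.
have [->|Q0] := eqVneq Q 0; first by rewrite mulr0 msize0.
by rewrite msizeM //; move: (msize P) (msize Q) hP hQ => s t; lia.
Qed.

Lemma msizeD_leq (n : nat) (P Q : {mpoly RR[n]}) (d : nat) :
  (msize P <= d)%N -> (msize Q <= d)%N -> (msize (P + Q) <= d)%N.
Proof. by move=> hP hQ; rewrite (leq_trans (msizeD_le _ _)) // geq_max hP. Qed.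

Lemma has_top1 (n : nat) : has_top (1 : {mpoly RR[n]}) 0%MM.
Proof. by rewrite /has_top mpolyX0 subrr msize0. Qed.

Lemma has_topXU (n : nat) (i : 'I_n) : has_top 'X_i U_(i)%MM.
Proof. by rewrite /has_top subrr msize0. Qed.

Lemma has_topXsubC (n : nat) (i : 'I_n) (c : RR) : has_top ('X_i - c%:MP) U_(i)%MM.
Proof. by rewrite /has_top addrAC subrr add0r msizeN msizeC mdeg1; case: eqP. Qed.

Lemma has_top_msize (n : nat) (P : {mpoly RR[n]}) g : has_top P g -> (msize P <= (mdeg g).+1)%N.
Proof.
move=> h; rewrite -[P](subrK 'X_[g]); apply: msizeD_leq; last by rewrite msizeX.
exact: leqW.
Qed.

Lemma has_topM (n : nat) (P Q : {mpoly RR[n]}) g h :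
  has_top P g -> has_top Q h -> has_top (P * Q) (g + h)%MM.
Proof.
move=> hP hQ; rewrite /has_top mpolyXD mdegD.
have -> : P * Q - 'X_[g] * 'X_[h] = P * (Q - 'X_[h]) + 'X_[h] * (P - 'X_[g]) by ring.
apply: msizeD_leq; first exact: msizeM_leq (has_top_msize hP) hQ.
by rewrite addnC; apply: msizeM_leq hP; rewrite msizeX.
Qed.

Lemma has_topX (n : nat) (P : {mpoly RR[n]}) g r : has_top P g -> has_top (P ^+ r) (g *+ r)%MM.
Proof.
move=> hP; elim: r => [|r IH]; first by rewrite mulm0n; apply: has_top1.
by rewrite exprS mulmS; apply: has_topM.
Qed.

Lemma has_top_prod (n : nat) (I : finType) (f : I -> {mpoly RR[n]}) (g : I -> 'X_{1..n}) :
  (forall i, has_top (f i) (g i)) -> has_top (\prod_i f i) (\big[+%MM/0%MM]_i g i).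
Proof.
move=> h; elim/big_rec2: _ => [|i x y _ IH]; first exact: has_top1.
by apply: has_topM.
Qed.

Definition posroots (m n : nat) (i : 'I_n) : {mpoly RR[n]} :=
  \prod_(j < m) ('X_i - (j.+1%:R)%:MP).

Lemma has_top_posroots (m n : nat) (i : 'I_n) : has_top (posroots m i) (U_(i) *+ m)%MM.
Proof.
rewrite /posroots; elim: m => [|m IH]; first by rewrite big_ord0 mulm0n; apply: has_top1.
by rewrite big_ord_recr mulmSr; apply: has_topM => //; apply: has_topXsubC.
Qed.

Lemma mult_ge_XsubC (n : nat) (i : 'I_n) (c : RR) (a : 'I_n -> RR) :
  a i = c -> mult_ge ('X_i - c%:MP) a 1.
Proof.
move=> ac g; rewrite /shift_mpoly rmorphB /= comp_mpolyXU comp_mpolyC -tnth_nth.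
by rewrite tnth_mktuple ac addrK msuppX inE => /eqP ->; rewrite mdeg1.
Qed.

Lemma mult_ge_XU (n : nat) (i : 'I_n) (a : 'I_n -> RR) : a i = 0 -> mult_ge 'X_i a 1.
Proof. by move=> a0; rewrite -['X_i]subr0 -(mpolyC0 n RR); apply: mult_ge_XsubC. Qed.

Lemma mult_ge_posroots (m n : nat) (i : 'I_n) (c : 'I_n -> nat) :
  (0 < c i <= m)%N -> mult_ge (posroots m i) (pt c) 1.
Proof.
case/andP=> c0 cm; have cm' : ((c i).-1 < m)%N by rewrite prednK.
rewrite /posroots (bigD1 (Ordinal cm')) //= -[1%N]addn0; apply: mult_geM => //.
by apply: mult_ge_XsubC; rewrite /pt prednK.
Qed.

Lemma mult_ge_allroots (m n : nat) (i : 'I_n) (c : 'I_n -> nat) :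
  (c i <= m)%N -> mult_ge ('X_i * posroots m i) (pt c) 1.
Proof.
move=> cm; have [c0|c0] := posnP (c i).
  by rewrite -[1%N]addn0; apply: mult_geM => //; apply: mult_ge_XU; rewrite /pt c0.
by rewrite -[1%N]add0n; apply: mult_geM => //; apply: mult_ge_posroots; rewrite c0.
Qed.

Lemma mult_ge_prod_posroots (m n : nat) (c : 'I_n -> nat) :
  grid_nz m c -> mult_ge (\prod_i posroots m i) (pt c) 1.
Proof.
case=> cm [i ci]; rewrite (bigD1 i) //= -[1%N]addn0; apply: mult_geM => //.
by apply: mult_ge_posroots; rewrite cm lt0n andbT; apply/eqP.
Qed.

Lemma posroots_coef0 (m n : nat) (i : 'I_n) : (posroots m i)@_0 != 0.
Proof.
rewrite /posroots rmorph_prod; apply/prodf_neq0 => j _ /=.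
by rewrite mcoeffB mcoeffX mcoeffC eqxx mulr1 mnm1_eq0 sub0r oppr_eq0 pnatr_eq0.
Qed.

Lemma prod_posroots_coef0 (m n : nat) : (\prod_(i < n) posroots m i)@_0 != 0.
Proof.
by rewrite rmorph_prod; apply/prodf_neq0 => i _ /=; apply: posroots_coef0.
Qed.

(** These are the admissible corrections: adding one preserves order [k] at the nonzero grid points
    and any order [l <= k - 2] at the origin. *)
Definition flat (m n k : nat) (P : {mpoly RR[n]}) : Prop :=
  vanishes_grid m k P /\ mult_ge P (@origin n) (k - 1).

Lemma origin_pt (n : nat) : @origin n = pt (fun=> 0%N).
Proof. by []. Qed.

(** Write [g i = m.+1 * q i + r i] and take [q i] factors ['X_i * posroots m i], which vanish on the
    whole grid. If the [q i] sum to at least [k], the powers ['X_i ^+ r i] complete the top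
    monomial. *)
Lemma reducible_monomial (m n k : nat) (g : 'X_{1..n}) : (0 < k)%N ->
  (m * n + m.+1 * (k - 1) <= mdeg g)%N ->
  exists G : {mpoly RR[n]}, flat m k G /\ has_top G g.
Proof.
move=> k0 hg.
pose q i := (g i %/ m.+1)%N; pose r i := (g i %% m.+1)%N.
have rm i : (r i <= m)%N by rewrite -ltnS ltn_pmod.
have topG (f : 'I_n -> {mpoly RR[n]}) : (forall i, has_top (f i) (U_(i) *+ r i)%MM) ->
    has_top ((\prod_i ('X_i * posroots m i) ^+ q i) * \prod_i f i) g.
  move=> hf; have -> : g = (\big[+%MM/0%MM]_i (U_(i) *+ m.+1 *+ q i) +
      \big[+%MM/0%MM]_i (U_(i) *+ r i))%MM.
    apply/mnmP => j; rewrite mnmDE !mnm_sumE (bigD1 j) //= [X in (_ + X)%N](bigD1 j) //=.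
    rewrite !big1 => [|i ij|i ij]; rewrite ?mulmnE ?mnm1E ?(negPf ij) //.
    by rewrite eqxx !mul1n !addn0 mulnC -divn_eq.
  apply: has_topM; apply: has_top_prod => // i.
  apply: has_topX; rewrite mulmS; apply: has_topM (has_top_posroots _ _).
  exact: has_topXU.
have multG c : (forall i, (c i <= m)%N) ->
    mult_ge (\prod_(i < n) ('X_i * posroots m i) ^+ q i) (pt c) (\sum_i q i).
  move=> cm; apply: mult_ge_prod => i; rewrite -[X in mult_ge _ _ X]muln1.
  by apply: mult_geX; apply: mult_ge_allroots.
have [kq|qk] := leqP k (\sum_i q i).
  exists ((\prod_i ('X_i * posroots m i) ^+ q i) * \prod_i 'X_i ^+ r i); split; last first.
    by apply: topG => i; apply: has_topX; apply: has_topXU.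
  split=> [c [cm _]|]; rewrite -[X in mult_ge _ _ X]addn0; apply: mult_geM => //.
    exact: mult_ge_leq kq (multG _ cm).
  by rewrite origin_pt; apply: mult_ge_leq (multG _ _); [lia | by []].
have gE : mdeg g = (m.+1 * \sum_i q i + \sum_i r i)%N.
  rewrite mdegE big_distrr -big_split /=; apply: eq_bigr => i _.
  by rewrite mulnC -divn_eq.
have mnE : (m * n = \sum_(i < n) m)%N by rewrite sum_nat_const card_ord mulnC.
have rle : (\sum_i r i <= m * n)%N by rewrite mnE leq_sum.
(* Otherwise the degree bound is tight: the [q i] sum to [k - 1] and every [r i] equals [m]. Then
   the product of all [posroots m i] completes the top monomial and supplies the missing zero away
   from the origin. *)
have sq : (\sum_i q i = k - 1)%N by nia.
have re i : r i = m.
  have sr : (\sum_i r i = m * n)%N by rewrite gE sq in hg; lia.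
  apply/eqP; rewrite eqn_leq rm /= leqNgt; apply/negP => ri.
  suff : (\sum_i r i < m * n)%N by rewrite sr ltnn.
  rewrite mnE (bigD1 i) //= [X in (_ < X)%N](bigD1 i) //=.
  by rewrite -addSn leq_add // leq_sum.
exists ((\prod_i ('X_i * posroots m i) ^+ q i) * \prod_i posroots m i); split; last first.
  by apply: topG => i; rewrite re; apply: has_top_posroots.
split=> [c cnz|].
  rewrite (_ : k = \sum_i q i + 1)%N; last by rewrite sq subnK.
  apply: mult_geM; last exact: mult_ge_prod_posroots.
  by apply: multG; case: cnz.
rewrite -[X in mult_ge _ _ X]addn0 -sq; apply: mult_geM => //.
by rewrite origin_pt; apply: multG.
Qed.

Lemma flat0 (m n k : nat) : flat m k (0 : {mpoly RR[n]}).
Proof. by split=> [c _|] g; rewrite /shift_mpoly rmorph0 msupp0. Qed.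

Lemma flatD (m n k : nat) (P Q : {mpoly RR[n]}) : flat m k P -> flat m k Q -> flat m k (P + Q).
Proof.
move=> [vP oP] [vQ oQ]; split; last exact: mult_geD.
by move=> c hc; apply: mult_geD; [apply: vP|apply: vQ].
Qed.

Lemma flatZ (m n k : nat) (c : RR) (P : {mpoly RR[n]}) : flat m k P -> flat m k (c *: P).
Proof.
by move=> [vP oP]; split; [move=> a ha; apply: mult_geZ; apply: vP | apply: mult_geZ].
Qed.

Lemma reduce_flat (m n k : nat) (P : {mpoly RR[n]}) : (0 < k)%N ->
  exists Q, flat m k Q /\ (msize (P - Q) <= m * n + m.+1 * (k - 1))%N.
Proof.
move=> k0; set D := (m * n + _)%N.
pose red P := exists Q : {mpoly RR[n]}, flat m k Q /\ (msize (P - Q) <= D)%N.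
have redS (S : {mpoly RR[n]}) : (forall g, g \in msupp S -> red 'X_[g]) -> red S.
  move=> h; rewrite (mpolyE S) big_seq; apply: (big_ind red).
  - by exists 0; rewrite subrr msize0; split=> //; apply: flat0.
  - move=> P1 P2 [Q1 [f1 s1]] [Q2 [f2 s2]]; exists (Q1 + Q2); split; first exact: flatD.
    by rewrite opprD addrACA; apply: msizeD_leq.
  - move=> g /h[Q [fQ sQ]]; exists (S@_g *: Q); split; first exact: flatZ.
    by rewrite -scalerBr (leq_trans (msizeZ_le _ _)).
(* Induction on the degree: [G - 'X_[g]] has only monomials of degree below [mdeg g], so it is
   already reducible. *)
have redX d g : (mdeg g < d)%N -> red 'X_[g].
  elim: d g => [//|d IH] g gd; have [Dg|gD] := leqP D (mdeg g); last first.
    by exists 0; rewrite subr0 msizeX; split=> //; apply: flat0.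
  have [G [fG tG]] := reducible_monomial k0 Dg.
  have [|Q [fQ sQ]] := redS (G - 'X_[g]).
    move=> h /msize_mdeg_lt hS; apply: IH.
    by apply: leq_trans (leq_trans hS tG) _; rewrite -ltnS.
  exists (G - Q); split; first by rewrite -scaleN1r; apply: flatD => //; apply: flatZ.
  by rewrite -msizeN opprB addrAC.
by apply: redS => g _; apply: (redX (mdeg g).+1).
Qed.

(** The coefficient of ['X_i ^+ l] is [P@_0], which [Q] cannot cancel because its terms have degree
    above [l]. *)
Lemma mult_eq_origin_XM (n l : nat) (i : 'I_n) (P Q : {mpoly RR[n]}) :
  P@_0 != 0 -> mult_ge Q (@origin n) l.+1 -> mult_eq ('X_i ^+ l * P + Q) (@origin n) l.
Proof.
move=> P0 hQ; split.
  apply: mult_geD; last exact: mult_ge_leq hQ.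
  rewrite -[X in mult_ge _ _ X]addn0; apply: mult_geM => //.
  by rewrite -[X in mult_ge _ _ X]muln1; apply: mult_geX; apply: mult_ge_XU.
move/(_ (U_(i) *+ l)%MM); rewrite shift_mpoly_origin mdegMn mdeg1 mul1n ltnn => h.
suff /h : (U_(i) *+ l)%MM \in msupp ('X_i ^+ l * P + Q) by [].
rewrite mcoeff_msupp mcoeffD [Q@__]memN_msupp_eq0 ?addr0.
  by rewrite mpolyXn mulrC -[X in _@_X]addm0 mcoeffMX.
apply/negP => hU; have := hQ (U_(i) *+ l)%MM.
by rewrite shift_mpoly_origin mdegMn mdeg1 mul1n ltnn => /(_ hU).
Qed.

Lemma degree_bound_top_sharp (m n k : nat) : (0 < m)%N -> (0 < n)%N -> (0 < k)%N ->
  exists P : {mpoly RR[n]},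
    [/\ vanishes_grid m k P, mult_eq P (@origin n) (k - 1) &
        tdeg P = (m * n + m.+1 * (k - 1))%N].
Proof.
move=> m0 n0 k0; pose i0 := Ordinal n0.
pose E : {mpoly RR[n]} := \prod_i posroots m i.
(* The power gives order [k - 1] on the whole grid, and [E] adds one zero everywhere except at the
   origin. *)
pose P := ('X_i0 * posroots m i0) ^+ (k - 1) * E.
have van : vanishes_grid m k P.
  move=> c hc; rewrite (_ : k = (k - 1) * 1 + 1)%N; last by lia.
  rewrite /P muln1 -{2}[(k - 1)%N]muln1; apply: mult_geM; last exact: mult_ge_prod_posroots.
  by apply: mult_geX; apply: mult_ge_allroots; case: hc.
have ord : mult_eq P (@origin n) (k - 1).
  rewrite -[P]addr0 /P exprMn -mulrA; apply: mult_eq_origin_XM.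
    by rewrite rmorphM rmorphXn mulf_neq0 ?expf_neq0 ?posroots_coef0 ?prod_posroots_coef0.
  by move=> g; rewrite /shift_mpoly rmorph0 msupp0.
exists P; split=> //; apply/eqP; rewrite eqn_leq degree_bound_top // andbT.
have : has_top P ((U_(i0) *+ m.+1) *+ (k - 1) + \big[+%MM/0%MM]_i (U_(i) *+ m))%MM.
  apply: has_topM; last by apply: has_top_prod => i; apply: has_top_posroots.
  apply: has_topX; rewrite mulmS; apply: has_topM (has_top_posroots _ _).
  exact: has_topXU.
move/has_top_msize; rewrite mdegD !mdegMn mdeg1 mul1n mdeg_sum.
under eq_bigr => i _ do rewrite mdegMn mdeg1 mul1n.
rewrite sum_nat_const card_ord /tdeg; move: (msize P) => s hs.
by rewrite addnC [(m * n)%N]mulnC; case: s hs.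
Qed.

Lemma degree_bound_low_sharp (m n k l : nat) : (0 < m)%N -> k \in [:: 2; 3; 4]%N ->
  (k - 1 <= n)%N -> (l <= k - 2)%N ->
  exists P : {mpoly RR[n]},
    [/\ vanishes_grid m k P, mult_eq P (@origin n) l &
        tdeg P = (m * n + m.+1 * (k - 1) - 1)%N].
Proof.
move=> m0 hk hn lk.
have k2 : (2 <= k)%N by move: hk; rewrite !inE => /or3P[] /eqP ->.
have n0 : (0 < n)%N by lia.
pose i0 := Ordinal n0.
(* [P] has the right orders but possibly too large a degree. Reduction by [Q] bounds the degree from
   above, and [degree_bound_low] turns the bound into equality. *)
pose P := 'X_i0 ^+ l * (\prod_i posroots m i) ^+ k : {mpoly RR[n]}.
have [|Q [[vQ oQ] sQ]] := @reduce_flat m n k P; first by lia.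
have van : vanishes_grid m k (P - Q).
  move=> c hc; apply: mult_geD; last by rewrite -scaleN1r; apply: mult_geZ; apply: vQ.
  rewrite -[X in mult_ge _ _ X]add0n; apply: mult_geM => //.
  rewrite -[X in mult_ge _ _ X]muln1; apply: mult_geX; exact: mult_ge_prod_posroots.
have ord : mult_eq (P - Q) (@origin n) l.
  apply: mult_eq_origin_XM.
    by rewrite rmorphXn expf_neq0 ?prod_posroots_coef0.
  by rewrite -scaleN1r; apply: mult_geZ; apply: mult_ge_leq oQ; lia.
exists (P - Q); split=> //; apply/eqP; rewrite eqn_leq (degree_bound_low m0 van ord) // andbT.
by rewrite /tdeg -subn1 leq_sub2r.
Qed.

Local Close Scope ring_scope.

Theorem theorem1p5 (m n k : nat) (hm : (0 < m)%N) (hn : (0 < n)%N) (hk : (2 <= k)%N) :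
  (* (i) lower bound *)
  (forall (P : {mpoly RR[n]}),
      vanishes_grid m k P -> mult_eq P (@origin n) (k - 1) ->
      (m * n + m.+1 * (k - 1) <= tdeg P)%N) /\
  (* (ii) lower bound *)
  (forall (P : {mpoly RR[n]}) (l : nat),
      vanishes_grid m k P -> mult_eq P (@origin n) l ->
      (l <= k - 2)%N -> k \in [:: 2; 3; 4]%N -> (k - 1 <= n)%N ->
      (m * n + m.+1 * (k - 1) - 1 <= tdeg P)%N) /\
  (* sharpness of (i) *)
  (exists P : {mpoly RR[n]},
      [/\ vanishes_grid m k P, mult_eq P (@origin n) (k - 1) &
          tdeg P = (m * n + m.+1 * (k - 1))%N]) /\
  (* sharpness of (ii) *)
  (k \in [:: 2; 3; 4]%N -> (k - 1 <= n)%N ->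
   forall l : nat, (l <= k - 2)%N ->
   exists P : {mpoly RR[n]},
      [/\ vanishes_grid m k P, mult_eq P (@origin n) l &
          tdeg P = (m * n + m.+1 * (k - 1) - 1)%N]).
Proof.
split; first by move=> P; apply: degree_bound_top => //; apply: ltnW.
split; first by move=> P l; apply: degree_bound_low.
split; first by apply: degree_bound_top_sharp => //; apply: ltnW.
by move=> hk4 hkn l; apply: degree_bound_low_sharp.
Qed.
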